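(* There is an absolute constant $c>0$ such that the following holds. Fix $q\in\mathbb{S}^{n-1}$ and set $$S_\star(q)=\sum_{k=1}^m\sum_{i\ne j}^n a_{kk}\,b_{ij}\,q_iq_j\,(u^k_iu^k_j-p_k^2),$$ which equals $\mathbb{E}(Z^TA^\diamond_{qq}Z\mid U)-\mathbb{E}(Z^TA^\diamond_{qq}Z)$. Then for every $t>0$, $$\mathbb{P}\big(|S_\star(q)|>t\big)\ \le\ 2\exp\bigg(-c\min\bigg(\frac{t^2}{a_\infty\|B_0\|_2\,\|(|b_{ij}|)\|_2\,\sum_{k=1}^ma_{kk}p_k^2},\ \frac{t}{a_\infty\|B_0\|_2}\bigg)\bigg).$$
   Context: $A_0=(a_{ij})\in\mathbb{R}^{m\times m}$ and $B_0=(b_{ij})\in\mathbb{R}^{n\times n}$ are symmetric positive definite, $\mathrm{tr}(B_0)=n$, $a_\infty=\max_ja_{jj}$; $(|b_{ij}|)$ is the entrywise absolute value of $B_0$; $\|\cdot\|_2$ is the operator norm; $\mathbb{S}^{n-1}$ is the unit sphere of $\mathbb{R}^n$. $U=[u^1|\cdots|u^m]\in\{0,1\}^{n\times m}$ has mutually independent entries with $u^k_i\sim\mathrm{Bernoulli}(p_k)$, $i=1,\dots,n$. $Z\in\mathbb{R}^{mn}$ is a subgaussian random vector with independent mean-zero unit-variance coordinates, independent of $U$, and $A^\diamond_{qq}=\sum_k\sum_{i\ne j}u^k_iu^k_jq_iq_j(c_jc_i^T)\otimes(d_kd_k^T)$, where $c_1,\dots,c_n$ and $d_1,\dots,d_m$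 are the columns of the symmetric square roots $B_0^{1/2}$ and $A_0^{1/2}$. Sums over $i\ne j$ are over ordered pairs of distinct indices. *)

(* Defs.v *)
From HB Require Import structures.
From mathcomp Require Import all_boot all_order all_algebra.
From mathcomp Require Import mxtens.
From mathcomp Require Import all_classical all_reals all_analysis.

Set Implicit Arguments.
Unset Strict Implicit.
Unset Printing Implicit Defensive.

Import Order.TTheory GRing.Theory Num.Theory.
Import numFieldNormedType.Exports.

Local Open Scope classical_set_scope.
Local Open Scope ring_scope.

Section Matrices.
Context {R : realType}.

Definition qform n (M : 'M[R]_n) (x : 'cV[R]_n) : R := (x^T *m M *m x) 0 0.

Definition sym_posdef n (M : 'M[R]_n) : Prop :=
  M^T = M /\ forall x : 'cV[R]_n, x != 0 -> 0 < qform M x.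

Definition sym_possemidef n (M : 'M[R]_n) : Prop :=
  M^T = M /\ forall x : 'cV[R]_n, 0 <= qform M x.

(* For a positive (semi)definite M there is exactly one such C, namely M^{1/2}. *)
Definition is_sqrtmx n (M C : 'M[R]_n) : Prop :=
  sym_possemidef C /\ C *m C = M.

(* The library norm on matrices is the largest absolute entry, so the Euclidean
   norm and its operator norm are introduced here. *)
Definition norm2 n (x : 'cV[R]_n) : R := Num.sqrt (\sum_(i < n) x i 0 ^+ 2).

Definition opnorm2 n (M : 'M[R]_n) : R :=
  sup [set norm2 (M *m x) | x in [set x : 'cV[R]_n | norm2 x = 1]].

Definition abs_mx n (M : 'M[R]_n) : 'M[R]_n := map_mx Num.norm M.

(* The default value 0 of the maximum is irrelevant when the diagonal of M is
   positive, e.g. when M is positive definite (and nonempty). *)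
Definition max_diag n (M : 'M[R]_n) : R := \big[Num.max/0]_(j < n) M j j.

Definition A_diamond m n (rA : 'M[R]_m) (rB : 'M[R]_n) (u : 'M[R]_(n, m))
    (q : 'cV[R]_n) : 'M[R]_(n * m) :=
  \sum_(k < m) \sum_(i < n) \sum_(j < n | i != j)
    (u i k * u j k * q i 0 * q j 0) *:
      ((col j rB *m (col i rB)^T) *t (col k rA *m (col k rA)^T)).

Definition S_star_of m n (A : 'M[R]_m) (B : 'M[R]_n) (p : 'I_m -> R)
    (u : 'M[R]_(n, m)) (q : 'cV[R]_n) : R :=
  \sum_(k < m) \sum_(i < n) \sum_(j < n | i != j)
    A k k * B i j * q i 0 * q j 0 * (u i k * u j k - p k ^+ 2).

End Matrices.

Section Probability.
Context {R : realType} {d : measure_display} {T : measurableType d}.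
Variable P : probability T R.

Definition mutually_independent (I : finType) (d' : measure_display)
    (T' : measurableType d') (X : I -> {RV P >-> T'}) : Prop :=
  forall (J : {set I}) (B : I -> set T'), (forall i, measurable (B i)) ->
    P (\bigcap_(i in [set` J]) (X i @^-1` B i)) =
    (\prod_(i in J) P (X i @^-1` B i))%E.

Definition sigma_of (I : Type) (d' : measure_display)
    (T' : measurableType d') (X : I -> T -> T') : set (set T) :=
  <<s \bigcup_i preimage_set_system setT (X i) measurable >>.

Definition independent_sigma (F G : set (set T)) : Prop :=
  forall A B, F A -> G B -> P (A `&` B) = (P A * P B)%E.

(* Y is a version of E(X | G), for a sub-sigma-algebra G of the events. *)
Definition is_cond_expectation (G : set (set T)) (X Y : T -> R) : Prop :=
  [/\ P.-integrable setT (EFin \o X),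
      P.-integrable setT (EFin \o Y),
      forall B : set R, measurable B -> G (Y @^-1` B) &
      forall E, G E -> (\int[P]_(w in E) (Y w)%:E = \int[P]_(w in E) (X w)%:E)%E].

(* Finiteness of the psi_2 norm. *)
Definition subgaussian (X : T -> R) : Prop :=
  exists2 K : R, 0 < K & ('E_P[(fun w => expR (X w ^+ 2 / K ^+ 2))] <= 2%:E)%E.

(* A random vector is subgaussian when all its one-dimensional marginals are. *)
Definition subgaussian_vector N (Z : 'I_N -> {RV P >-> R}) : Prop :=
  forall x : 'cV[R]_N, subgaussian (fun w => \sum_(l < N) x l 0 * Z l w).

Definition random_matrix m n (U : 'I_n -> 'I_m -> {RV P >-> bool}) (w : T) :
  'M[R]_(n, m) := \matrix_(i, k) (U i k w)%:R.

Definition random_vector N (Z : 'I_N -> {RV P >-> R}) (w : T) : 'cV[R]_N :=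
  \col_l Z l w.

End Probability.

Arguments mutually_independent {R d T} P {I d' T'} X.
Arguments subgaussian_vector {R d T} P {N} Z.

(* Main.v *)
(** Conditionally on U, the mean-zero unit-variance independent coordinates of Z turn
    the quadratic form into the trace of A_diamond, which is S_star plus a constant.

    For the tail, S_star is a centered off-diagonal quadratic form sum c_xy u_x u_y in
    the independent Bernoulli variables u_x, x = (i, k), with
    c_(i,k)(j,k) = a_kk b_ij q_i q_j.  Its absolute row sums are at most
    L = a_inf |B|_2 (Cauchy-Schwarz along a row of B), and
    sum |c_xy| p_x p_y is at most V = | |b_ij| |_2 sum_k a_kk p_k^2.
    When L <= 1/9, replacing the u_x by the p_x one at a time inside the exponential, with
    exp s <= 1 + s + s^2, gives
    E exp (sum c_xy u_x u_y) <= exp (sum c_xy p_x p_y + 9 L V); the quadratic error is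
    absorbed linearly because (sum_y c_xy v_y)^2 <= L sum_y |c_xy| v_y for 0 <= v <= 1.
    Chernoff's bound applied to lambda c then concludes. *)

Require Import Defs.
From HB Require Import structures.
From mathcomp Require Import all_boot all_order all_algebra.
From mathcomp Require Import ring lra mxtens.
From mathcomp Require Import all_classical all_reals all_analysis.
From mathcomp Require Import measurable_realfun.

Set Implicit Arguments.
Unset Strict Implicit.
Unset Printing Implicit Defensive.

Import Order.TTheory GRing.Theory Num.Theory.
Import numFieldNormedType.Exports.

Local Open Scope classical_set_scope.
Local Open Scope ring_scope.

(** * Independent Bernoulli variables *)

Section BernoulliAverage.
Context {R : realType} {I : finType}.
Variable p : I -> R.
Hypothesis p01 : forall i, 0 <= p i <= 1.
Implicit Types (u : {ffun I -> bool}) (f g : {ffun I -> bool} -> R).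

Definition bern_weight u : R := \prod_i bernoulli_pmf (p i) (u i).

(** Expectation under the product Bernoulli law. As a finite weighted sum it keeps the moment bound
    free of measure theory; [joint_prob] connects it with [P]. *)
Definition bern_mean f : R := \sum_u bern_weight u * f u.

Definition set_coord u x b : {ffun I -> bool} :=
  [ffun i => if i == x then b else u i].

Lemma bern_weight_ge0 u : 0 <= bern_weight u.
Proof. by apply: prodr_ge0 => i _; exact: bernoulli_pmf_ge0. Qed.

Lemma bern_mean_le f g : (forall u, f u <= g u) -> bern_mean f <= bern_mean g.
Proof. by move=> fg; apply: ler_sum => u _; rewrite ler_wpM2l ?bern_weight_ge0. Qed.

Lemma bern_mean_cst (r : R) : bern_mean (fun=> r) = r.
Proof.
rewrite /bern_mean -mulr_suml -[RHS]mul1r; congr (_ * _).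
rewrite /bern_weight -(bigA_distr_bigA (fun i => bernoulli_pmf (p i))) big1 // => i _.
by rewrite big_bool /= addrC subrK.
Qed.

(** Conditioning on all coordinates but [x]: pair each [u] with its flip at [x]. The averaged
    function is constant on such a pair, and the two weights are in the ratio [p x] to [1 - p x]. *)
Lemma bern_mean_coord x f :
  bern_mean f = bern_mean (fun u => p x * f (set_coord u x true)
                                    + (1 - p x) * f (set_coord u x false)).
Proof.
(* Each pair is represented by its member with [u x = true]. *)
have splitE (h : {ffun I -> bool} -> R) : \sum_u h u =
    \sum_(u : {ffun I -> bool} | u x) (h (set_coord u x true) + h (set_coord u x false)).
  rewrite (bigID (fun u => u x)) big_split /=; congr (_ + _).
    apply: eq_bigr => u ux; congr h; apply/ffunP => i; rewrite ffunE.
    by case: eqP => // ->.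
  rewrite (reindex_onto (fun u => set_coord u x false)
    (fun u => set_coord u x true)) /=.
    apply: eq_bigl => u; rewrite ffunE eqxx /=.
    apply/eqP/idP => [<-|ux]; first by rewrite ffunE eqxx.
    by apply/ffunP => i; rewrite !ffunE; case: eqP => // ->.
  move=> u /negbTE ux; apply/ffunP => i; rewrite !ffunE.
  by case: eqP => // ->.
have wE u b : bern_weight (set_coord u x b) =
    bernoulli_pmf (p x) b * \prod_(i | i != x) bernoulli_pmf (p i) (u i).
  rewrite /bern_weight (bigD1 x) //= ffunE eqxx; congr (_ * _).
  by apply: eq_bigr => i /negbTE ix; rewrite ffunE ix.
have setK u b b' : set_coord (set_coord u x b) x b' = set_coord u x b'.
  by apply/ffunP => i; rewrite !ffunE; case: eqP.
rewrite /bern_mean !splitE; apply: eq_bigr => u _.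
rewrite !setK !wE /=; ring.
Qed.

End BernoulliAverage.

(** Squaring [1 - s / 2 <= expR (- s / 2)] and inverting bounds [expR s] by [(1 - s / 2) ^- 2]. The
    comparison with [1 + s + s ^+ 2] then comes down to [1 - 3 * s + s ^+ 2 >= 0], whence the bound
    [1 / 3]. *)
Lemma expR_le_1Dsqr {R : realType} (s : R) : s <= 1 / 3 -> expR s <= 1 + s + s ^+ 2.
Proof.
move=> s3.
have h0 : 0 < 1 - s / 2 by lra.
have h1 : (1 - s / 2) ^+ 2 <= expR (- s).
  have -> : - s = 2%:R * (- (s / 2)) by field.
  rewrite expRM_natl ler_sqr ?nnegrE ?expR_ge0 ?(ltW h0) //.
  exact: expR_ge1Dx.
rewrite -[s in expR s]opprK expRN invf_ple ?posrE ?expR_gt0 //; last by nra.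
apply: le_trans h1; rewrite invf_ple ?posrE ?exprn_gt0 //; last by nra.
rewrite -[leLHS]mul1r ler_pdivrMr ?exprn_gt0 //.
have -> : (1 + s + s ^+ 2) * (1 - s / 2) ^+ 2 =
   1 + s ^+ 2 / 4 * (1 - 3 * s + s ^+ 2) by field.
by rewrite lerDl mulr_ge0 ?divr_ge0 ?sqr_ge0 //; nra.
Qed.

(** The effect of one coordinate on the exponent. Since [9 * L <= 1], the earlier error [9 * L * a]
    is at most [z], so the increment [s] satisfies [|s| <= 3 * z] and [s ^+ 2 <= 9 * L * z]. This is
    where the constant 9 reproduces itself. *)
Lemma bernoulli_mgf_le {R : realType} (p L y a z : R) : 0 <= p <= 1 ->
  L <= 1 / 9 -> z <= L -> `|y| <= z -> 0 <= a <= z ->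
  p * expR (2 * y + 9 * L * a) + (1 - p) <=
  expR (p * (2 * y + 9 * L * a + 9 * L * z)).
Proof.
move=> /andP[p0 p1] L9 zL yz /andP[a0 az].
have z0 : 0 <= z by exact: le_trans az.
have L0 : 0 <= L by exact: le_trans zL.
have /andP[y1 y2] : - z <= y <= z by rewrite -ler_norml.
have La : 9 * L * a <= z.
  by apply: le_trans az; rewrite -[leRHS]mul1r ler_wpM2r //; lra.
have La0 : 0 <= 9 * L * a by rewrite !mulr_ge0.
set s := 2 * y + 9 * L * a.
have s3 : `|s| <= 3 * z by rewrite ler_norml /s; apply/andP; split; lra.
have s2 : s ^+ 2 <= 9 * L * z.
  rewrite -real_normK ?num_real //.
  have : `|s| ^+ 2 <= (3 * z) ^+ 2 by rewrite ler_sqr ?nnegrE ?mulr_ge0.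
  by move/le_trans; apply; nra.
have s13 : s <= 1 / 3 by have := le_trans (ler_norm s) s3; lra.
apply: le_trans (expR_ge1Dx _).
have := expR_le_1Dsqr s13; clearbody s; nra.
Qed.

(** * Exponential moment of a quadratic form in Bernoulli variables *)

Section QuadraticMoment.
Context {R : realType} {I : finType}.

Definition qsum (c : I -> I -> R) (v : I -> R) : R :=
  \sum_i \sum_j c i j * v i * v j.

(** A vanishing diagonal entry makes the form affine in coordinate [x], with slope row sum plus
    column sum. The value [v x] has no influence, being multiplied by [c x x] or replaced by 0. *)
Lemma qsum_affine (c : I -> I -> R) (v w : I -> R) x : c x x = 0 ->
  (forall i, i != x -> w i = v i) ->
  qsum c w = qsum c (fun i => if i == x then 0 else v i)
             + w x * (\sum_j c x j * v j + \sum_i c i x * v i).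
Proof.
move=> cxx wv; rewrite /qsum (bigD1 x) //= [in RHS](bigD1 x) //= eqxx.
rewrite [X in _ = X + _ + _]big1; last by move=> j _; rewrite mulr0 mul0r.
rewrite add0r mulrDr addrC.
have -> : \sum_(i | i != x) \sum_j c i j * w i * w j =
    \sum_(i | i != x) \sum_j
       c i j * (if i == x then 0 else v i) * (if j == x then 0 else v j)
    + w x * \sum_i c i x * v i.
  rewrite mulr_sumr [X in _ + X](bigD1 x) //= cxx mul0r mulr0 add0r -big_split /=.
  apply: eq_bigr => i ix; rewrite (negbTE ix) (bigD1 x) //= [in RHS](bigD1 x) //=.
  rewrite eqxx mulr0 add0r addrC wv //; congr (_ + _); last by rewrite mulrC.
  by apply: eq_bigr => j jx; rewrite (negbTE jx) wv.
rewrite -addrA [X in _ + X]addrC; congr (_ + (_ + _)).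
rewrite mulr_sumr; apply: eq_bigr => j _.
have [->|jx] := eqVneq j x; first by rewrite cxx !mul0r mulr0.
by rewrite (wv j jx); ring.
Qed.

Variables (p : I -> R) (c : I -> I -> R) (L : R).
Hypotheses (p01 : forall i, 0 <= p i <= 1) (csym : forall i j, c i j = c j i).
Hypotheses (c0 : forall i, c i i = 0) (cL : forall i, \sum_j `|c i j| <= L).
Hypothesis L9 : L <= 1 / 9.

(** Hybrid point: the coordinates in [s] are already replaced by their means, the others are still
    random. *)
Let frozen (s : seq I) (u : {ffun I -> bool}) i : R :=
  if i \in s then p i else (u i)%:R.

(** Only the rows in [s] count, one for each replacement made so far; once [s] covers [I] this is
    the full absolute form. *)
Let error (s : seq I) (v : I -> R) : R :=
  qsum (fun i j => (i \in s)%:R * `|c i j|) v.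

Let frozen01 s u i : 0 <= frozen s u i <= 1.
Proof. by rewrite /frozen; case: ifP => // _; case: (u i); rewrite ?lexx ler01. Qed.

Let psi s u : R := expR (qsum c (frozen s u) + 9 * L * error s (frozen s u)).

(* Averaging over u_x replaces u_x by p_x in the exponent, at the cost of the error
   term 9 L p_x sum_j |c_xj| v_j: row x is added to [error]. *)
Let freeze_coord s x (u : {ffun I -> bool}) : x \notin s ->
  p x * psi s (set_coord u x true) + (1 - p x) * psi s (set_coord u x false)
  <= psi (x :: s) u.
Proof.
move=> xs; set v := frozen (x :: s) u.
have vb b i : i != x -> frozen s (set_coord u x b) i = v i.
  by move=> ix; rewrite /v /frozen ffunE in_cons (negbTE ix).
have vx b : frozen s (set_coord u x b) x = b%:R.
  by rewrite /frozen (negbTE xs) ffunE eqxx.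
have v_x : v x = p x by rewrite /v /frozen mem_head.
pose y : R := \sum_j c x j * v j.
(* The slope of [error s] in coordinate [x]: column [x] only, because row [x] is absent as long as
   [x] is not in [s]. *)
pose a : R := \sum_i (i \in s)%:R * `|c i x| * v i.
pose ya : R := \sum_j `|c x j| * v j.
pose q0 : R := qsum c (fun i => if i == x then 0 else v i).
pose e0 : R := error s (fun i => if i == x then 0 else v i).
have v0 i : 0 <= v i by have /andP[] := frozen01 (x :: s) u i.
have v1 i : v i <= 1 by have /andP[] := frozen01 (x :: s) u i.
have qE w : (forall i, i != x -> w i = v i) -> qsum c w = q0 + w x * (2 * y).
  move=> wv; rewrite (qsum_affine (c0 x) wv); congr (_ + _ * _).
  rewrite -/y (_ : \sum_i _ = y); first by ring.
  by apply: eq_bigr => i _; rewrite csym.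
have eE w : (forall i, i != x -> w i = v i) -> error s w = e0 + w x * a.
  move=> wv; rewrite /error (qsum_affine _ wv) ?c0 ?normr0 ?mulr0 //.
  congr (_ + _ * _); rewrite (_ : \sum_j _ = 0) ?add0r //.
  by apply: big1 => j _; rewrite (negbTE xs) !mul0r.
have e'E : error (x :: s) v = e0 + p x * a + p x * ya.
  rewrite /error (@qsum_affine _ v v x) ?c0 ?normr0 ?mulr0 //.
  rewrite v_x -addrA -mulrDr; congr (_ + _ * _).
    apply: eq_bigr => i _; apply: eq_bigr => j _; rewrite in_cons.
    by case: eqP => //= _; rewrite !mulr0 !mul0r.
  rewrite addrC; congr (_ + _); apply: eq_bigr => i _; rewrite in_cons ?eqxx ?mul1r //.
  by case: eqP => //= ->; rewrite c0 normr0 !mulr0.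
rewrite /psi -/v !qE ?eE ?vx ?e'E ?v_x; do ?by [|exact: vb].
have ya_ge0 : 0 <= ya by apply: sumr_ge0 => j _; rewrite mulr_ge0.
have yaL : ya <= L.
  apply: le_trans (cL x); apply: ler_sum => j _.
  by rewrite -[leRHS]mulr1 ler_wpM2l.
have yya : `|y| <= ya.
  apply: le_trans (ler_norm_sum _ _ _) _; apply: ler_sum => j _.
  by rewrite normrM (ger0_norm (v0 j)).
have a_ge0 : 0 <= a by apply: sumr_ge0 => i _; rewrite !mulr_ge0.
have a_ya : a <= ya.
  apply: ler_sum => i _; rewrite csym; case: (i \in s); rewrite ?mul1r //.
  by rewrite !mul0r mulr_ge0.
clearbody y a ya q0 e0.
(* The factor [expR (q0 + 9 * L * e0)] does not depend on coordinate [x] and is taken out; what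
   remains is [bernoulli_mgf_le] with [z := ya]. *)
have -> : q0 + true%:R * (2 * y) + 9 * L * (e0 + true%:R * a)
  = (q0 + 9 * L * e0) + (2 * y + 9 * L * a) by rewrite !mul1r; ring.
have -> : q0 + false%:R * (2 * y) + 9 * L * (e0 + false%:R * a)
  = q0 + 9 * L * e0 by rewrite !mul0r !addr0.
have -> : q0 + p x * (2 * y) + 9 * L * (e0 + p x * a + p x * ya)
  = (q0 + 9 * L * e0) + p x * (2 * y + 9 * L * a + 9 * L * ya) by ring.
rewrite (expRD (q0 + _) (2 * y + _)) (expRD (q0 + _) (p x * _)).
rewrite mulrCA [X in _ + X]mulrC -mulrDr ler_wpM2l ?expR_ge0 //.
by apply: bernoulli_mgf_le => //; rewrite a_ge0.
Qed.

(** Induction on the list of frozen coordinates: by [freeze_coord] the mean of [psi s] can only grow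
    with [s]. For [s = enum I] the exponent is deterministic and equals the right-hand side. *)
Lemma bern_mean_expR_quad :
  bern_mean p (fun u => expR (qsum c (fun i => (u i)%:R))) <=
  expR (qsum c p + 9 * L * qsum (fun i j => `|c i j|) p).
Proof.
have main s : bern_mean p (fun u => expR (qsum c (fun i => (u i)%:R))) <=
    bern_mean p (psi s).
  elim: s => [|x s IH].
    apply: bern_mean_le => // u; rewrite /psi /error /frozen /qsum.
    rewrite [X in _ * X]big1 ?mulr0 ?addr0 //.
    by move=> i _; rewrite big1 // => j _; rewrite in_nil !mul0r.
  (* A repeated coordinate changes nothing, since [psi] depends on [s] only through membership. *)
  apply: le_trans IH _; have [xs|xs] := boolP (x \in s).
    apply: bern_mean_le => // u.
    have frE : frozen (x :: s) u = frozen s u.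
      by apply/funext => i; rewrite /frozen in_cons; case: eqP => // ->; rewrite xs.
    rewrite /psi frE (_ : error (x :: s) = error s) //; apply/funext => v.
    apply: eq_bigr => i _; apply: eq_bigr => j _; rewrite in_cons.
    by case: eqP => // ->; rewrite xs.
  rewrite (bern_mean_coord _ x); apply: bern_mean_le => // u.
  exact: freeze_coord.
apply: le_trans (main (enum I)) _.
rewrite -[leRHS](bern_mean_cst p); apply: bern_mean_le => // u.
rewrite /psi /error /frozen ler_expR lerD //.
  by rewrite le_eqVlt; apply/orP; left; apply/eqP; apply: eq_bigr => i _;
     apply: eq_bigr => j _; rewrite !mem_enum.
rewrite le_eqVlt; apply/orP; left; apply/eqP; congr (_ * _).
by apply: eq_bigr => i _; apply: eq_bigr => j _; rewrite !mem_enum mul1r.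
Qed.

End QuadraticMoment.

(* [e] plays the role of min (t ^ 2 / (L V)) (t / L); the product form of [eV] allows
   V = 0. *)
Section QuadraticTail.
Context {R : realType} {I : finType}.
Variables (p : I -> R) (L V t e : R).
Hypotheses (p01 : forall i, 0 <= p i <= 1) (L0 : 0 < L) (t0 : 0 < t).
Hypotheses (eL : e <= t / L) (eV : V * L * e <= t ^+ 2).

Let qsumZ r (c : I -> I -> R) v : qsum (fun i j => r * c i j) v = r * qsum c v.
Proof.
rewrite /qsum mulr_sumr; apply: eq_bigr => i _; rewrite mulr_sumr.
by apply: eq_bigr => j _; rewrite !mulrA.
Qed.

(** The Chernoff exponent [9 * l ^+ 2 * L * V - l * t] is minimal at [l = t / (18 * L * V)], which
    is admissible when [t <= 2 * V] and gives [- t ^+ 2 / (36 * L * V)]. For larger [t] the largest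
    admissible [l = 1 / (9 * L)] gives at most [- t / (18 * L)]. *)
Let upper_tail (c : I -> I -> R) (csym : forall i j, c i j = c j i)
    (c0 : forall i, c i i = 0) (cL : forall i, \sum_j `|c i j| <= L)
    (cV : qsum (fun i j => `|c i j|) p <= V) :
  bern_mean p (fun u => (t < qsum c (fun i => (u i)%:R) - qsum c p)%R%:R)
  <= expR (- (e / 36)).
Proof.
(* Markov's inequality: the indicator is at most [expR (l * (X - t))] for the centred form [X], and
   the moment bound applies to [l * c], whose row sums are at most [l * L]. *)
have chernoff l : 0 <= l -> l * L <= 1 / 9 ->
    bern_mean p (fun u => (t < qsum c (fun i => (u i)%:R) - qsum c p)%R%:R)
    <= expR (9 * l ^+ 2 * L * V - l * t).
  move=> l0 lL.
  pose c' i j := l * c i j.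
  have c'sym i j : c' i j = c' j i by rewrite /c' csym.
  have c'0 i : c' i i = 0 by rewrite /c' c0 mulr0.
  have c'L i : \sum_j `|c' i j| <= l * L.
    rewrite (eq_bigr (fun j => l * `|c i j|)); last first.
      by move=> j _; rewrite /c' normrM ger0_norm.
    by rewrite -mulr_sumr ler_wpM2l.
  have := bern_mean_expR_quad p01 c'sym c'0 c'L lL.
  move=> /(ler_wpM2l (expR_ge0 (- (l * (t + qsum c p))))).
  rewrite -expRD qsumZ (_ : qsum (fun i j => `|c' i j|) p =
    l * qsum (fun i j => `|c i j|) p); last first.
    rewrite -qsumZ; apply: eq_bigr => i _; apply: eq_bigr => j _.
    by rewrite /c' normrM ger0_norm.
  move=> main; apply: (@le_trans _ _ (expR (- (l * (t + qsum c p)) +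
     (l * qsum c p + 9 * (l * L) * (l * qsum (fun i j => `|c i j|) p))))); last first.
    rewrite ler_expR; set W := qsum (fun i j => `|c i j|) p in cV *.
    have : l ^+ 2 * L * W <= l ^+ 2 * L * V.
      by rewrite ler_wpM2l // mulr_ge0 ?sqr_ge0 ?ltW.
    by lra.
  apply: le_trans main; rewrite /bern_mean mulr_sumr; apply: ler_sum => u _.
  rewrite mulrCA ler_wpM2l ?bern_weight_ge0 // qsumZ -expRD.
  case: ltP => [tX|_]; last exact: expR_ge0.
  apply: le_trans (expR_ge1Dx _); rewrite lerDl.
  have : 0 <= l * (qsum c (fun i => (u i)%:R) - qsum c p - t).
    by rewrite mulr_ge0 // subr_ge0 ltW.
  by lra.
have V0 : 0 <= V.
  apply: le_trans cV; apply: sumr_ge0 => i _; apply: sumr_ge0 => j _.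
  by have /andP[? _] := p01 i; have /andP[? _] := p01 j; rewrite !mulr_ge0.
have [tV|Vt] := leP t (2 * V).
  have {}V0 : 0 < V by have := t0; lra.
  apply: le_trans (chernoff (t / (18 * L * V)) _ _) _.
  - by rewrite divr_ge0 ?mulr_ge0 ?ltW.
  - rewrite (_ : t / (18 * L * V) * L = t / (18 * V)); last by field; rewrite !gt_eqF.
    by rewrite ler_pdivrMr ?mulr_gt0 //; have := t0; lra.
  rewrite ler_expR (_ : _ - _ = - (t ^+ 2 / (V * L) / 36)).
    by rewrite lerN2 ler_pM2r ?invr_gt0 // ler_pdivlMr ?mulr_gt0 // mulrC.
  by field; rewrite !gt_eqF.
apply: le_trans (chernoff (1 / (9 * L)) _ _) _.
- by rewrite divr_ge0 ?mulr_ge0 ?ltW.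
- by rewrite (_ : 1 / (9 * L) * L = 1 / 9) //; field; rewrite gt_eqF.
rewrite ler_expR (_ : _ - _ = - ((t - V) / L) / 9); last by field; rewrite gt_eqF.
have : t / L / 2 <= (t - V) / L.
  by rewrite -mulrA mulrCA mulrC ler_pM2r ?invr_gt0 //; have := t0; lra.
have : 0 <= t / L by rewrite divr_ge0 ?ltW.
have := eL; lra.
Qed.

(** The conditions on [c] are invariant under a change of sign, so [upper_tail] for [- c] bounds the
    lower tail; the union of both gives the factor 2. *)
Lemma bern_mean_quad_tail (c : I -> I -> R) (csym : forall i j, c i j = c j i)
    (c0 : forall i, c i i = 0) (cL : forall i, \sum_j `|c i j| <= L)
    (cV : qsum (fun i j => `|c i j|) p <= V) :
  bern_mean p (fun u => (t < `|qsum c (fun i => (u i)%:R) - qsum c p|)%R%:R)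
  <= 2 * expR (- (e / 36)).
Proof.
have qN v : qsum (fun i j => - c i j) v = - qsum c v.
  by rewrite -mulN1r -qsumZ; apply: eq_bigr => i _; apply: eq_bigr => j _; rewrite mulN1r.
have tl := upper_tail csym c0 cL cV.
have := @upper_tail (fun i j => - c i j) (fun i j => congr1 -%R (csym i j)).
have tn : forall i, - c i i = 0 by move=> i; rewrite c0 oppr0.
move/(_ tn).
have nE i : \sum_j `|- c i j| = \sum_j `|c i j|.
  by apply: eq_bigr => j _; rewrite normrN.
have nqE : qsum (fun i j => `|- c i j|) p = qsum (fun i j => `|c i j|) p.
  by apply: eq_bigr => i _; apply: eq_bigr => j _; rewrite normrN.
rewrite nqE => /(_ (fun i => eq_ind_r (fun z => z <= L) (cL i) (nE i)) cV) tr.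
rewrite mulrDl mul1r; apply: le_trans (lerD tl tr).
rewrite /bern_mean -big_split /=; apply: ler_sum => u _.
rewrite -mulrDr ler_wpM2l ?bern_weight_ge0 // !qN -opprD.
set X := qsum _ _ + - _; clearbody X.
case: (ltP t `|X|) => [|_]; last by rewrite addr_ge0.
by rewrite lter_normr => /orP[] ->; rewrite ?lerDl ?lerDr.
Qed.

End QuadraticTail.

(** * The law of a finite Boolean family as a finite weighted sum *)

Definition joint_value {T : Type} {I : finType} (X : I -> T -> bool) (w : T) :
  {ffun I -> bool} := [ffun i => X i w].

Lemma measurable_joint {d : measure_display} {T : measurableType d} {I : finType}
    (X : I -> T -> bool) (S : set {ffun I -> bool}) :
  (forall i, measurable_fun [set: T] (X i)) -> measurable (joint_value X @^-1` S).
Proof.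
move=> mX.
have -> : joint_value X @^-1` S = \bigcup_(u in S) \bigcap_(i in [set: I])
    (X i @^-1` [set u i]).
  apply/seteqP; split => w /= => [Sw|[u Su uw]].
    by exists (joint_value X w) => // i _ /=; rewrite ffunE.
  rewrite (_ : joint_value X w = u) //.
  by apply/ffunP => i; rewrite ffunE; exact: uw.
apply: fin_bigcup_measurable => // u _; apply: fin_bigcap_measurable => // i _.
by rewrite -[_ @^-1` _]setTI; exact: mX.
Qed.

Section BernoulliLaw.
Context {R : realType} {d : measure_display} {T : measurableType d}.
Variable P : probability T R.
Context {I : finType} (p : I -> R) (X : I -> {RV P >-> bool}).
Hypotheses (p01 : forall i, 0 <= p i <= 1).
Hypotheses (Xp : forall i, distribution P (X i) = bernoulli_prob (p i)).
Hypothesis indX : mutually_independent P X.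

Let fiberE u : [set w | joint_value X w = u] =
  \bigcap_(i in [set` [set: I]%SET]) (X i @^-1` [set u i]).
Proof.
apply/seteqP; split => w /= => [<- i _ /=|h]; first by rewrite ffunE.
by apply/ffunP => i; rewrite ffunE; apply: (h i); rewrite /= inE.
Qed.

Lemma joint_fiber_prob u :
  P [set w | joint_value X w = u] = (bern_weight p u)%:E.
Proof.
rewrite fiberE (@indX [set: I]%SET (fun i => [set u i])) //.
rewrite /bern_weight -prodEFin; apply: eq_big => [i|i _]; first by rewrite inE.
rewrite -[P _]/(distribution P (X i) [set u i]) Xp /bernoulli_prob p01.
by rewrite fsbig_set1.
Qed.

(** The event is a finite disjoint union of fibres of [joint_value], and independence gives each
    fibre its [bern_weight]. *)
Lemma joint_prob (S : pred {ffun I -> bool}) :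
  P [set w | S (joint_value X w)] = (bern_mean p (fun u => (S u)%:R))%:E.
Proof.
pose D := [seq u <- index_enum {ffun I -> bool} | S u].
have -> : [set w | S (joint_value X w)] =
    \bigcup_(u in [set` D]) [set w | joint_value X w = u].
  apply/seteqP; split => w /= => [Sw|[u uD /= ->]].
    by exists (joint_value X w) => //=; rewrite mem_filter Sw mem_index_enum.
  by move: uD; rewrite /= mem_filter => /andP[].
rewrite measure_fin_bigcup //=; last 2 first.
- by move=> u v _ _ [w [/= <- <-]].
- by move=> u _; apply: (measurable_joint [set u]) => i; exact: measurable_funP.
rewrite -fsbig_seq ?filter_uniq ?index_enum_uniq // big_filter.
rewrite (eq_bigr (fun u => (bern_weight p u)%:E)); last first.
  by move=> u _; exact: joint_fiber_prob.
rewrite sumEFin /bern_mean big_mkcond /=; congr (_%:E); apply: eq_bigr => u _.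
by case: (S u); rewrite ?mulr1 ?mulr0.
Qed.

End BernoulliLaw.

(** * The coefficients of S_star *)

Section Norms.
Context {R : realType}.

(** Lagrange's identity: twice the difference of the two sides is the double sum of the squares
    [(a i * b j - a j * b i) ^+ 2]. *)
Lemma cauchy_schwarz_sum (I : finType) (a b : I -> R) :
  (\sum_i a i * b i) ^+ 2 <= (\sum_i a i ^+ 2) * (\sum_i b i ^+ 2).
Proof.
have : 0 <= \sum_i \sum_j (a i * b j - a j * b i) ^+ 2.
  by apply: sumr_ge0 => i _; apply: sumr_ge0 => j _; exact: sqr_ge0.
have -> : \sum_i \sum_j (a i * b j - a j * b i) ^+ 2 =
    \sum_i \sum_j a i ^+ 2 * b j ^+ 2 + \sum_i \sum_j b i ^+ 2 * a j ^+ 2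
    - 2 * \sum_i \sum_j (a i * b i) * (a j * b j).
  rewrite mulr_sumr -big_split -sumrB; apply: eq_bigr => i _ /=.
  rewrite mulr_sumr -big_split -sumrB; apply: eq_bigr => j _ /=; ring.
have prodE (f g : I -> R) : \sum_i \sum_j f i * g j = (\sum_i f i) * (\sum_j g j).
  by rewrite mulr_suml; apply: eq_bigr => i _; rewrite mulr_sumr.
by rewrite !prodE; nra.
Qed.

Lemma norm2_sqr n (x : 'cV[R]_n) : norm2 x ^+ 2 = \sum_i x i 0 ^+ 2.
Proof. by rewrite sqr_sqrtr // sumr_ge0 // => i _; exact: sqr_ge0. Qed.

Lemma opnorm2_ub n (M : 'M[R]_n) (x : 'cV[R]_n) :
  norm2 x = 1 -> norm2 (M *m x) <= opnorm2 M.
Proof.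
move=> x1; apply: ub_le_sup; last by exists x.
(* The Frobenius norm bounds the set, so the supremum is a true upper bound. *)
exists (Num.sqrt (\sum_i \sum_j M i j ^+ 2)) => _ [y /= y1 <-].
rewrite ler_sqrt; last by apply: sumr_ge0 => i _; apply: sumr_ge0 => j _; exact: sqr_ge0.
apply: ler_sum => i _; rewrite mxE -[leRHS]mulr1.
have -> : 1 = \sum_j y j 0 ^+ 2 by rewrite -norm2_sqr y1 expr1n.
exact: cauchy_schwarz_sum.
Qed.

Lemma norm2_delta n (i : 'I_n) : norm2 (delta_mx i 0 : 'cV[R]_n) = 1.
Proof.
rewrite /norm2 (bigD1 i) //= big1 ?addr0 => [|j /negbTE ji].
  by rewrite mxE !eqxx expr1n sqrtr1.
by rewrite mxE ji expr0n.
Qed.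

Lemma col_sqr_le_opnorm2 n (M : 'M[R]_n) (i : 'I_n) :
  \sum_j M j i ^+ 2 <= opnorm2 M ^+ 2.
Proof.
have := opnorm2_ub M (norm2_delta i).
have -> : M *m delta_mx i 0 = col i M by rewrite colE.
move=> h; rewrite (eq_bigr (fun j => (col i M) j 0 ^+ 2)) -?norm2_sqr; last first.
  by move=> j _; rewrite mxE.
by rewrite ler_sqr ?nnegrE ?sqrtr_ge0 //; apply: le_trans h; exact: sqrtr_ge0.
Qed.

Lemma coord_le_norm2 n (x : 'cV[R]_n) i : `|x i 0| <= norm2 x.
Proof.
rewrite -(ler_pXn2r (_ : 0 < 2)%N) ?nnegrE ?sqrtr_ge0 // norm2_sqr.
rewrite real_normK ?num_real // (bigD1 i) //= lerDl.
by apply: sumr_ge0 => j _; exact: sqr_ge0.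
Qed.

Lemma opnorm2_ge0 n (M : 'M[R]_n) (i : 'I_n) : 0 <= opnorm2 M.
Proof. by apply: le_trans (opnorm2_ub M (norm2_delta i)); exact: sqrtr_ge0. Qed.

(** Drop [|q i 0| <= 1] and apply Cauchy-Schwarz to the rest: by symmetry row [i] is column [i],
    that is, [B] applied to a basis vector, of Euclidean norm at most [opnorm2 B]. *)
Lemma row_le_opnorm2 n (B : 'M[R]_n) (q : 'cV[R]_n) i :
  B^T = B -> norm2 q = 1 ->
  \sum_j `|B i j * q i 0 * q j 0| <= opnorm2 B.
Proof.
move=> Bsym q1.
apply: (@le_trans _ _ (\sum_j `|B j i| * `|q j 0|)).
  apply: ler_sum => j _; rewrite -{1}Bsym mxE !normrM ler_wpM2r //.
  by rewrite -[leRHS]mulr1 ler_wpM2l // -q1 coord_le_norm2.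
rewrite -(ler_pXn2r (_ : 0 < 2)%N) ?nnegrE ?(opnorm2_ge0 _ i) //; last first.
  by apply: sumr_ge0 => j _; rewrite mulr_ge0.
apply: le_trans (cauchy_schwarz_sum _ _) _.
rewrite (eq_bigr (fun j => B j i ^+ 2)); last by move=> j _; rewrite real_normK ?num_real.
rewrite [X in _ * X](eq_bigr (fun j => q j 0 ^+ 2)); last first.
  by move=> j _; rewrite real_normK ?num_real.
by rewrite -norm2_sqr q1 expr1n mulr1 col_sqr_le_opnorm2.
Qed.

(** The sum is the quadratic form of [abs_mx B] at the entrywise absolute value of [q], which is
    again a unit vector. *)
Lemma sum_le_opnorm2_abs n (B : 'M[R]_n) (q : 'cV[R]_n) : norm2 q = 1 ->
  \sum_i \sum_j `|B i j * q i 0 * q j 0| <= opnorm2 (abs_mx B).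
Proof.
move=> q1; pose r : 'cV[R]_n := map_mx Num.norm q.
have r1 : norm2 r = 1.
  rewrite -q1 /norm2; congr Num.sqrt; apply: eq_bigr => i _.
  by rewrite mxE real_normK ?num_real.
apply: le_trans (opnorm2_ub (abs_mx B) r1).
rewrite (eq_bigr (fun i => r i 0 * (abs_mx B *m r) i 0)); last first.
  move=> i _; rewrite !mxE mulr_sumr; apply: eq_bigr => j _.
  by rewrite !mxE !normrM mulrCA mulrA.
rewrite -(ler_pXn2r (_ : 0 < 2)%N) ?nnegrE ?sqrtr_ge0 //; last first.
  apply: sumr_ge0 => i _; rewrite !mxE mulr_ge0 // sumr_ge0 // => j _.
  by rewrite !mxE mulr_ge0.
apply: le_trans (cauchy_schwarz_sum _ _) _.
by rewrite -!norm2_sqr r1 expr1n mul1r.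
Qed.

Lemma posdef_diag_gt0 n (M : 'M[R]_n) i : sym_posdef M -> 0 < M i i.
Proof.
move=> [_ /(_ (delta_mx i 0))].
have -> : qform M (delta_mx i 0) = M i i.
  by rewrite /qform trmx_delta -rowE -colE !mxE.
apply; apply/eqP => /matrixP/(_ i 0); rewrite !mxE !eqxx => /eqP.
by rewrite oner_eq0.
Qed.

Lemma posdef_opnorm2_gt0 n (M : 'M[R]_n) (i : 'I_n) : sym_posdef M -> 0 < opnorm2 M.
Proof.
move=> /posdef_diag_gt0 - /(_ i) Mii.
apply: lt_le_trans (opnorm2_ub M (norm2_delta i)).
apply: lt_le_trans (coord_le_norm2 _ i).
by rewrite -colE mxE gtr0_norm.
Qed.

Lemma diag_le_max_diag n (M : 'M[R]_n) i : M i i <= max_diag M.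
Proof. by rewrite /max_diag (bigD1 i) //= le_max lexx. Qed.

End Norms.

(** * S_star as a Bernoulli quadratic form, and its tail *)

Section SStarTail.
Context {R : realType} {m n : nat}.
Variables (A : 'M[R]_m) (B : 'M[R]_n) (p : 'I_m -> R) (q : 'cV[R]_n).

Let idx := ('I_n * 'I_m)%type.

(** Block diagonal in the column index: block [k] is [A k k] times the off-diagonal part of the
    entrywise product of [B] with [q *m q^T]. *)
Definition S_coef (x y : idx) : R :=
  if (x.2 == y.2) && (x.1 != y.1)
  then A x.2 x.2 * (B x.1 y.1 * q x.1 0 * q y.1 0) else 0.

Lemma sum_offdiag (G : 'I_n -> R) (x : idx) :
  \sum_y (if (x.2 == y.2) && (x.1 != y.1) then G y.1 else 0) =
  \sum_(j | x.1 != j) G j.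
Proof.
rewrite -(pair_bigA _ (fun j l => if (x.2 == l) && (x.1 != j) then G j else 0)) /=.
rewrite [RHS]big_mkcond; apply: eq_bigr => j _.
case: (x.1 != j); last by apply: big1 => l _; rewrite andbF.
rewrite (bigD1 x.2) //= eqxx big1 ?addr0 // => l /negbTE lx.
by rewrite eq_sym lx.
Qed.

(** Shared by the random form, its value at the means and the absolute form: the block structure
    collapses the sum over pairs of indices to a triple sum. *)
Lemma qsum_S_coef (c : idx -> idx -> R) (F : 'I_n -> 'I_n -> 'I_m -> R) v :
  (forall x y, c x y * v x * v y =
    if (x.2 == y.2) && (x.1 != y.1) then F x.1 y.1 x.2 else 0) ->
  qsum c v = \sum_k \sum_i \sum_(j | i != j) F i j k.
Proof.
move=> cF; rewrite exchange_big /=.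
rewrite (pair_bigA _ (fun i k => \sum_(j | i != j) F i j k)) /=.
apply: eq_bigr => x _; rewrite -sum_offdiag; apply: eq_bigr => y _.
exact: cF.
Qed.

Lemma S_star_qsum (u : 'M[R]_(n, m)) :
  S_star_of A B p u q =
  qsum S_coef (fun x => u x.1 x.2) - qsum S_coef (fun x => p x.2).
Proof.
rewrite (@qsum_S_coef _ (fun i j k =>
  A k k * B i j * q i 0 * q j 0 * (u i k * u j k))); last first.
  move=> [i k] [j l]; rewrite /S_coef /=; case: eqP => [<-|_] /=; last by rewrite !mul0r.
  by case: eqP => _ /=; rewrite ?mul0r //; ring.
rewrite (@qsum_S_coef _ (fun i j k =>
  A k k * B i j * q i 0 * q j 0 * p k ^+ 2)); last first.
  move=> [i k] [j l]; rewrite /S_coef /=; case: eqP => [<-|_] /=; last by rewrite !mul0r.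
  by case: eqP => _ /=; rewrite ?mul0r //; ring.
rewrite -sumrB; apply: eq_bigr => k _; rewrite -sumrB; apply: eq_bigr => i _.
by rewrite -sumrB; apply: eq_bigr => j _; rewrite mulrBr.
Qed.

Hypotheses (hA : sym_posdef A) (hB : sym_posdef B) (hq : norm2 q = 1).
Hypothesis p01 : forall k, 0 <= p k <= 1.

Lemma S_coef_sym x y : S_coef x y = S_coef y x.
Proof.
rewrite /S_coef eq_sym [x.1 == _]eq_sym; case: eqP => [->|] //=; case: ifP => // _.
have <- : B^T x.1 y.1 = B y.1 x.1 by rewrite mxE.
rewrite (proj1 hB).
by ring.
Qed.

Lemma S_coef_diag x : S_coef x x = 0.
Proof. by rewrite /S_coef !eqxx. Qed.

Lemma S_coef_row x : \sum_y `|S_coef x y| <= max_diag A * opnorm2 B.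
Proof.
rewrite (eq_bigr (fun y => if (x.2 == y.2) && (x.1 != y.1) then
   A x.2 x.2 * `|B x.1 y.1 * q x.1 0 * q y.1 0| else 0)); last first.
  move=> y _; rewrite /S_coef; case: ifP => _; rewrite ?normr0 //.
  by rewrite normrM gtr0_norm // posdef_diag_gt0.
rewrite (sum_offdiag (fun j => A x.2 x.2 * `|B x.1 j * q x.1 0 * q j 0|)).
rewrite -mulr_sumr ler_pM ?sumr_ge0 ?diag_le_max_diag //.
  by rewrite ltW // posdef_diag_gt0.
apply: le_trans (row_le_opnorm2 x.1 (proj1 hB) hq).
by rewrite big_mkcond; apply: ler_sum => j _; case: ifP.
Qed.

Lemma S_coef_total :
  qsum (fun x y => `|S_coef x y|) (fun x => p x.2) <=
  opnorm2 (abs_mx B) * \sum_k A k k * p k ^+ 2.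
Proof.
rewrite (@qsum_S_coef _ (fun i j k =>
  A k k * p k ^+ 2 * `|B i j * q i 0 * q j 0|)); last first.
  move=> x y; rewrite /S_coef; case: eqP => [<-|_] /=; last by rewrite normr0 !mul0r.
  case: eqP => _ /=; rewrite ?normr0 ?mul0r //.
  by rewrite normrM gtr0_norm ?posdef_diag_gt0 //; ring.
rewrite mulrC mulr_suml; apply: ler_sum => k _.
have Ap : 0 <= A k k * p k ^+ 2.
  by rewrite mulr_ge0 ?sqr_ge0 // ltW // posdef_diag_gt0.
apply: le_trans (ler_wpM2l Ap (sum_le_opnorm2_abs B hq)).
rewrite mulr_sumr; apply: ler_sum => i _.
rewrite mulr_sumr [leLHS]big_mkcond; apply: ler_sum => j _.
by case: ifP => // _; rewrite mulr_ge0.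
Qed.

Context {d : measure_display} {T : measurableType d}.
Variables (P : probability T R) (U : 'I_n -> 'I_m -> {RV P >-> bool}).
Hypotheses (hU : forall i k, distribution P (U i k) = bernoulli_prob (p k)).
Hypothesis hUind : mutually_independent P (fun ik : 'I_n * 'I_m => U ik.1 ik.2).
Hypotheses (hm : (0 < m)%N) (hn : (0 < n)%N).

(* When the variance proxy is 0 (all p_k = 0), the extended-real quotient t ^ 2 / 0 is
   +oo and the minimum is t / L. *)
Lemma S_star_tail (t : R) : 0 < t ->
  (P [set w | (t < `|S_star_of A B p (random_matrix U w) q|)%R] <=
   2%:E * expeR (- ((1 / 36)%:E *
     mine ((t ^+ 2)%:E /
           (max_diag A * opnorm2 B * opnorm2 (abs_mx B) *
            \sum_(k < m) A k k * p k ^+ 2)%:E)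
          (t%:E / (max_diag A * opnorm2 B)%:E))))%E.
Proof.
move=> t0.
pose X (x : idx) : {RV P >-> bool} := U x.1 x.2.
pose Q (u : {ffun idx -> bool}) : R :=
  qsum S_coef (fun x => (u x)%:R) - qsum S_coef (fun x => p x.2).
have QE w : S_star_of A B p (random_matrix U w) q = Q (joint_value X w).
  rewrite S_star_qsum; congr (_ - _); apply: eq_bigr => x _.
  by apply: eq_bigr => y _; rewrite !ffunE !mxE.
under eq_set do rewrite QE.
have pX x : 0 <= p (x : idx).2 <= 1 by [].
have UX x : distribution P (X x) = bernoulli_prob (p x.2) by exact: hU.
(* The event depends on [U] only through [joint_value], so its probability is a [bern_mean]. *)
rewrite (joint_prob pX UX hUind
   (fun u => (t < `|Q u|)%R)) //.
set L := max_diag A * opnorm2 B.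
set V := opnorm2 (abs_mx B) * \sum_(k < m) A k k * p k ^+ 2.
have L0 : 0 < L.
  rewrite mulr_gt0 ?(posdef_opnorm2_gt0 (Ordinal hn)) //.
  by apply: lt_le_trans (diag_le_max_diag A (Ordinal hm)); exact: posdef_diag_gt0.
have V0 : 0 <= V.
  rewrite mulr_ge0 ?(opnorm2_ge0 _ (Ordinal hn)) // sumr_ge0 // => k _.
  by rewrite mulr_ge0 ?sqr_ge0 // ltW // posdef_diag_gt0.
rewrite -mulrA -/V.
have [e [eL eV ->]] : exists e : R, [/\ e <= t / L, V * L * e <= t ^+ 2 &
    (mine ((t ^+ 2)%:E / (L * V)%:E) (t%:E / L%:E) = e%:E)%E].
  rewrite [in X in mine _ X]inver gt_eqF //.
  have [V00|Vn0] := eqVneq V 0.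
    exists (t / L); split => //; first by rewrite V00 !mul0r sqr_ge0.
    by rewrite V00 mulr0 inver eqxx gt0_muley ?lte_fin ?exprn_gt0 // minye.
  have VL : 0 < V * L by rewrite mulr_gt0 // lt_def Vn0.
  exists (Num.min (t ^+ 2 / (V * L)) (t / L)); split.
  - by rewrite ge_min lexx orbT.
  - by rewrite mulrC -ler_pdivlMr // ge_min lexx.
  - by rewrite inver mulrC gt_eqF // -EFin_min.
rewrite -EFinM lee_fin.
rewrite (_ : 1 / 36 * e = e / 36); last by rewrite mul1r mulrC.
apply: (bern_mean_quad_tail (L := L) (V := V)) => //.
- exact: S_coef_sym.
- exact: S_coef_diag.
- exact: S_coef_row.
- exact: S_coef_total.
Qed.

End SStarTail.

(** * Conditional expectation of the quadratic form *)

Section IndependentProduct.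
Local Open Scope ereal_scope.
Context {R : realType} {d : measure_display} {T : measurableType d}.
Variables (P : probability T R) (X Y : {RV P >-> R}).
Hypothesis indXY : forall A B : set R, measurable A -> measurable B ->
  P (X @^-1` A `&` Y @^-1` B) = P (X @^-1` A) * P (Y @^-1` B).
Hypotheses (intX : P.-integrable setT (EFin \o X)).
Hypotheses (intY : P.-integrable setT (EFin \o Y)).

Let W w := (X w, Y w).

Let mW : measurable_fun setT W.
Proof. by apply: measurable_fun_pair; exact: measurable_funP. Qed.

Local Notation dX := (distribution P X).
Local Notation dY := (distribution P Y).
Let f (z : R * R) : \bar R := (z.1 * z.2)%:E.

Let mf : measurable_fun [set: R * R] f.
Proof. by apply/measurable_EFinP; exact: measurable_funM. Qed.

(** Independence is agreement on rectangles, and these determine the product measure. *)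
Let jointE : forall S, measurable S -> (dX \x dY) S = pushforward P W S.
Proof.
move=> S mS; have := @product_measure_unique _ _ _ _ R dX dY (pushforward P W).
apply => // A B mA mB; rewrite /pushforward /= -indXY //.
Qed.

Let marginal_integrable (Z : {RV P >-> R}) : P.-integrable setT (EFin \o Z) ->
  (distribution P Z).-integrable setT (EFin : R -> \bar R).
Proof. by move=> iZ; apply: integrable_pushforward. Qed.

(** By Tonelli the integral of [|x * y|] is the product of the two first absolute moments, both
    finite. *)
Let integrable_f : (dX \x dY).-integrable setT f.
Proof.
apply/integrable12ltyP => //.
have /integrableP[_] := marginal_integrable intY.
have /integrableP[_] := marginal_integrable intX.
set cX := integral _ _ _; set cY := integral _ _ _ => cXoo cYoo.
have mabs : measurable_fun [set: R] (fun y : R => `|y|%:E).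
  by apply/measurable_EFinP; exact: normr_measurable.
have cY0 : 0 <= cY by exact: integral_ge0.
rewrite (_ : integral _ _ _ = cX * cY).
  have cX0 : 0 <= cX by exact: integral_ge0.
  by apply: lte_mul_pinfty => //; rewrite ge0_fin_numE.
rewrite -ge0_integralZr //; apply: eq_integral => x _.
rewrite -ge0_integralZl //; apply: eq_integral => y _.
by rewrite /f /= normrM EFinM.
Qed.

Lemma integrable_indepM : P.-integrable setT (EFin \o (X \* Y)%R).
Proof.
apply/integrableP; split.
  by apply/measurable_EFinP; apply: measurable_funM; exact: measurable_funP.
have /integrableP[_] := integrable_f.
rewrite (eq_measure_integral (pushforward P W)); last by move=> S mS _; exact: jointE.
by rewrite ge0_integral_pushforward //; exact: measurableT_comp.
Qed.

Lemma integral_indepM :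
  \int[P]_w (X w * Y w)%:E = \int[P]_w (X w)%:E * \int[P]_w (Y w)%:E.
Proof.
transitivity (\int[dX \x dY]_z f z).
  rewrite (eq_measure_integral (pushforward P W)); last by move=> S mS _; exact: jointE.
  rewrite integral_pushforward //; exact: integrable_indepM.
rewrite -integral12_prod_meas1 // /fubini_F /f /=.
have iX := marginal_integrable intX; have iY := marginal_integrable intY.
have EE (Z : {RV P >-> R}) : P.-integrable setT (EFin \o Z) ->
    \int[P]_w (Z w)%:E = \int[distribution P Z]_x x%:E.
  by move=> iZ; rewrite integral_pushforward.
rewrite !EE // -[X in _ * X]fineK; last exact: integrable_fin_num.
rewrite -integralZr //; apply: eq_integral => x _.
rewrite fineK; last exact: integrable_fin_num.
rewrite -integralZl //; apply: eq_integral => y _.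
Qed.

End IndependentProduct.

(** * Measurability with respect to generated sigma-algebras *)

Section SigmaOf.
Context {d : measure_display} {T : measurableType d} {I : Type}.
Context {d' : measure_display} {T' : measurableType d'} (X : I -> T -> T').

(** The generators of [sigma_of X]. With them [g_sigma_algebraType sigma_gen] is a measurable space,
    and being determined by [X] becomes ordinary measurability on it. *)
Definition sigma_gen : set (set T) :=
  \bigcup_i preimage_set_system setT (X i) measurable.

Lemma measurable_fun_sigma_gen i :
  measurable_fun [set: g_sigma_algebraType sigma_gen] (X i).
Proof. by move=> _ B mB; apply: sub_sigma_algebra; exists i => //; exists B. Qed.

Lemma sigma_of_measurable (E : set T) :
  (forall i, measurable_fun setT (X i)) -> sigma_of X E -> measurable E.
Proof.
move=> mX; apply: smallest_sub E; first exact: sigma_algebra_measurable.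
by move=> _ [i _ [B mB <-]]; exact: mX.
Qed.

Lemma sigma_of_preimage {d2} {T2 : measurableType d2} (f : T -> T2) (B : set T2) :
  measurable_fun [set: g_sigma_algebraType sigma_gen] f -> measurable B ->
  sigma_of X (f @^-1` B).
Proof.
move=> mf mB; rewrite -[_ @^-1` _]setTI.
exact: mf.
Qed.

End SigmaOf.

Section BooleanFunction.
Context {R : realType} {d : measure_display} {T : measurableType d} {I : finType}.
Variables (X : I -> T -> bool) (F : {ffun I -> bool} -> R).
Hypothesis mX : forall i, measurable_fun [set: T] (X i).

Lemma measurable_fun_joint : measurable_fun [set: T] (F \o joint_value X).
Proof.
by move=> _ B mB; rewrite setTI comp_preimage; exact: measurable_joint.
Qed.

(** Only finitely many values occur, and the sum of their absolute values is a bound. *)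
Lemma integrable_joint (P : probability T R) (E : set T) : measurable E ->
  P.-integrable E (EFin \o (F \o joint_value X)).
Proof.
move=> mE; apply: measurable_bounded_integrable => //.
- exact: le_lt_trans (probability_le1 P mE) (ltry 1).
- by apply: measurable_funTS; exact: measurable_fun_joint.
exists (\sum_u `|F u|); split; first exact: num_real.
move=> M FM w _ /=; apply: le_trans (ltW FM).
by rewrite (bigD1 (joint_value X w)) //= lerDl sumr_ge0.
Qed.

End BooleanFunction.

Lemma integral_setE {R : realType} {d : measure_display} {T : measurableType d}
    (P : {measure set T -> \bar R}) (E : set T) (f : T -> R) :
  (\int[P]_(w in E) (f w)%:E = \int[P]_w (\1_E w * f w)%:E)%E.
Proof.
rewrite integral_mkcond; apply: eq_integral => w _.
by rewrite /patch indicE; case: ifP => _; rewrite ?mul1r ?mul0r.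
Qed.

(** * Integrals of a function of X times two coordinates of Z *)

Section RandomQuadraticForm.
Context {R : realType} {d : measure_display} {T : measurableType d}.
Variable P : probability T R.
Context {I : finType} {N : nat} (X : I -> {RV P >-> bool}) (Z : 'I_N -> {RV P >-> R}).
Hypothesis Zind : mutually_independent P Z.
Hypothesis Z0 : forall l, ('E_P[Z l] = 0)%E.
Hypothesis Z1 : forall l, ('V_P[Z l] = 1)%E.
Hypothesis XZ : independent_sigma P (sigma_of X) (sigma_of Z).

Let mX i : measurable_fun [set: T] (X i). Proof. exact: measurable_funP. Qed.

Let Zsqr l : (\int[P]_w (Z l w * Z l w)%:E = 1)%E.
Proof.
rewrite -(Z1 l) /variance covariance.unlock Z0 expectation.unlock.
by apply: eq_integral => w _; rewrite fctE /= !subr0.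
Qed.

Let integrable_sqr l : P.-integrable setT (EFin \o (Z l \* Z l)).
Proof.
apply/integrableP; split.
  by apply/measurable_EFinP; apply: measurable_funM; exact: measurable_funP.
rewrite (eq_integral (fun w => (Z l w * Z l w)%:E)) ?Zsqr ?ltry // => w _ /=.
by rewrite ger0_norm // -expr2 sqr_ge0.
Qed.

(** Domination by [1 + Z l ^+ 2], integrable because the second moment is 1. *)
Let integrableZ l : P.-integrable setT (EFin \o Z l).
Proof.
apply: (@le_integrable _ _ _ P setT _ _ (EFin \o (fun w => 1 + Z l w * Z l w))) => //.
- by apply/measurable_EFinP; exact: measurable_funP.
- move=> w _ /=; rewrite lee_fin [leRHS]ger0_norm; last by nra.
  by rewrite ler_norml; apply/andP; split; nra.
- rewrite (_ : _ \o _ = (EFin \o cst 1%R) \+ (EFin \o (Z l \* Z l)%R))%E //.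
  apply: integrableD => //; exact: finite_measure_integrable_cst.
Qed.

Let coord_indep l l' : l != l' -> forall A B : set R, measurable A -> measurable B ->
  P (Z l @^-1` A `&` Z l' @^-1` B) = (P (Z l @^-1` A) * P (Z l' @^-1` B))%E.
Proof.
move=> ll' A B mA mB; have l'l : l' != l by rewrite eq_sym.
pose C i := if i == l then A else B.
have mC i : measurable (C i) by rewrite /C; case: ifP.
have := @Zind [set l; l']%SET C mC.
rewrite big_setU1 ?inE //= big_set1 /C eqxx (negbTE l'l) => <-.
congr (P _); apply/seteqP; split => w /=.
  move=> [Aw Bw] i; rewrite /= !inE => /orP[] /eqP ->; first by rewrite eqxx.
  by rewrite (negbTE l'l).
move=> h; have := h l; have := h l'; rewrite /= !inE !eqxx orbT (negbTE l'l).
by move=> /(_ isT) ? /(_ isT).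
Qed.

Lemma integrable_coordM l l' : P.-integrable setT (EFin \o (Z l \* Z l')).
Proof.
have [<-|ll'] := eqVneq l l'; first exact: integrable_sqr.
by apply: integrable_indepM => //; exact: coord_indep.
Qed.

Lemma integral_coordM l l' :
  (\int[P]_w (Z l w * Z l' w)%:E = ((l == l')%:R : R)%:E)%E.
Proof.
have [<-|ll'] := eqVneq l l'; first exact: Zsqr.
rewrite integral_indepM //; last exact: coord_indep.
by have := Z0 l; rewrite expectation.unlock => ->; rewrite mul0e.
Qed.

Variable F : {ffun I -> bool} -> R.

Let G w := F (joint_value X w).

(** One factor is measurable for [sigma_of X], the other for [sigma_of Z]. Including the indicator
    of [E] turns integrals over [E] into expectations of independent products. *)
Let indicG_indep (E : set T) l l' : sigma_of X E ->
  forall A B : set R, measurable A -> measurable B ->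
  P ((fun w => \1_E w * G w)%R @^-1` A `&` (Z l \* Z l')%R @^-1` B) =
  (P ((fun w => \1_E w * G w)%R @^-1` A) * P ((Z l \* Z l')%R @^-1` B))%E.
Proof.
move=> XE A B mA mB; apply: XZ; apply: sigma_of_preimage => //.
  apply: measurable_funM; first exact: measurable_indic.
  by apply: measurable_fun_joint => i; exact: measurable_fun_sigma_gen.
by apply: measurable_funM; exact: measurable_fun_sigma_gen.
Qed.

Lemma integrable_joint_coordM l l' :
  P.-integrable setT (EFin \o (fun w => G w * (Z l w * Z l' w))).
Proof.
have XT : sigma_of X setT by exact: (@measurableT _ (g_sigma_algebraType (sigma_gen X))).
have mG : measurable_fun [set: T] (fun w => \1_setT w * G w).
  by apply: measurable_funM; [exact: measurable_indic|exact: measurable_fun_joint].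
have mZ : measurable_fun [set: T] (Z l \* Z l').
  by apply: measurable_funM; exact: measurable_funP.
have := @integrable_indepM R d T P (mfun_Sub (mem_set mG)) (mfun_Sub (mem_set mZ))
  (indicG_indep l l' XT).
rewrite (_ : EFin \o _ = EFin \o (fun w => G w * (Z l w * Z l' w))); last first.
  by apply/funext => w /=; rewrite indicT mul1r.
apply; last exact: integrable_coordM.
rewrite (_ : EFin \o _ = EFin \o (F \o joint_value X)); last first.
  by apply/funext => w /=; rewrite indicT mul1r.
exact: integrable_joint.
Qed.

(** The expectation of the independent product factors, and the second factor is the covariance of
    [Z l] and [Z l']. *)
Lemma integral_joint_coordM (E : set T) l l' : sigma_of X E ->
  (\int[P]_(w in E) (G w * (Z l w * Z l' w))%:E =
   ((l == l')%:R : R)%:E * \int[P]_(w in E) (G w)%:E)%E.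
Proof.
move=> XE; have mE : measurable E by exact: sigma_of_measurable XE.
have mG : measurable_fun [set: T] (fun w => \1_E w * G w).
  by apply: measurable_funM; [exact: measurable_indic|exact: measurable_fun_joint].
have mZ : measurable_fun [set: T] (Z l \* Z l').
  by apply: measurable_funM; exact: measurable_funP.
have := @integral_indepM R d T P (mfun_Sub (mem_set mG)) (mfun_Sub (mem_set mZ))
  (indicG_indep l l' XE).
rewrite !(integral_setE P E) /= integral_coordM muleC => <-.
- by apply: eq_integral => w _; congr (_%:E); rewrite [LHS]mulrA.
- apply: (@le_integrable _ _ _ P setT _ _ (EFin \o (F \o joint_value X))) => //.
  + exact/measurable_EFinP.
  + move=> w _ /=; rewrite lee_fin normrM ler_piMl // indicE.
    by case: (_ \in _); rewrite ?normr1 ?normr0.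
  + exact: integrable_joint.
- exact: integrable_coordM.
Qed.

End RandomQuadraticForm.

(** * Quadratic forms in Z whose matrix is a function of X *)

Section ConditionalQuadraticForm.
Context {R : realType} {d : measure_display} {T : measurableType d}.
Variable P : probability T R.
Context {I : finType} {N : nat} (X : I -> {RV P >-> bool}) (Z : 'I_N -> {RV P >-> R}).
Hypothesis Zind : mutually_independent P Z.
Hypothesis Z0 : forall l, ('E_P[Z l] = 0)%E.
Hypothesis Z1 : forall l, ('V_P[Z l] = 1)%E.
Hypothesis XZ : independent_sigma P (sigma_of X) (sigma_of Z).
Variable M : {ffun I -> bool} -> 'M[R]_N.

Let Q w := qform (M (joint_value X w)) (random_vector Z w).

Let QE w : Q w = \sum_l \sum_l' M (joint_value X w) l l' * (Z l w * Z l' w).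
Proof.
rewrite /Q /qform mxE exchange_big; apply: eq_bigr => l' _ /=.
rewrite mxE mulr_suml; apply: eq_bigr => l _.
by rewrite !mxE mulrCA mulrA.
Qed.

Let QEfin : EFin \o Q = (fun w => \sum_l \sum_l'
  (M (joint_value X w) l l' * (Z l w * Z l' w))%:E)%E.
Proof.
apply/funext => w /=; rewrite QE -sumEFin; apply: eq_bigr => l _.
by rewrite sumEFin.
Qed.

Let iM l l' : P.-integrable setT
  (EFin \o (fun w => M (joint_value X w) l l' * (Z l w * Z l' w))).
Proof. exact: (integrable_joint_coordM Zind Z0 Z1 XZ (fun u => M u l l')). Qed.

Lemma integrable_qform : P.-integrable setT (EFin \o Q).
Proof.
rewrite QEfin; apply: integrable_sum => // l _; apply: integrable_sum => // l' _.
exact: iM.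
Qed.

(** Uncorrelated coordinates leave only the diagonal terms. This is the defining identity for the
    trace to be the conditional expectation given [X]. *)
Lemma integral_qform (E : set T) : sigma_of X E ->
  (\int[P]_(w in E) (Q w)%:E = \int[P]_(w in E) (\tr (M (joint_value X w)))%:E)%E.
Proof.
move=> XE; have mE : measurable E.
  by apply: sigma_of_measurable XE => i; exact: measurable_funP.
have iME l l' : P.-integrable E
    (EFin \o (fun w => M (joint_value X w) l l' * (Z l w * Z l' w))).
  exact: integrableS (iM l l').
rewrite (eq_integral (fun w => \sum_l \sum_l'
  (M (joint_value X w) l l' * (Z l w * Z l' w))%:E)%E); last first.
  by move=> w _; rewrite -[LHS]/((EFin \o Q) w) QEfin.
rewrite integral_sum //; last first.
  by move=> l; apply: integrable_sum => // l' _; exact: iME.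
under [RHS]eq_integral do rewrite /mxtrace -sumEFin.
rewrite integral_sum //; last first.
  by move=> l; apply: (integrable_joint (fun u => M u l l)) => // i; exact: measurable_funP.
apply: eq_bigr => l _; rewrite integral_sum //; last by move=> l'; exact: iME.
rewrite (bigD1 l) //= big1 ?adde0.
  rewrite (integral_joint_coordM Zind Z0 Z1 XZ (fun u => M u l l)) //.
  by rewrite eqxx mul1e.
move=> l' l'l; rewrite (integral_joint_coordM Zind Z0 Z1 XZ (fun u => M u l l')) //.
by rewrite eq_sym (negbTE l'l) mul0e.
Qed.

End ConditionalQuadraticForm.

(** * The trace of A_diamond and the mean of S_star *)

Section SStarMean.
Context {R : realType} {m n : nat}.
Variables (A : 'M[R]_m) (B : 'M[R]_n) (p : 'I_m -> R) (q : 'cV[R]_n).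

Lemma mxtrace_tens m' n' (C : 'M[R]_m') (D : 'M[R]_n') : \tr (C *t D) = \tr C * \tr D.
Proof.
rewrite /mxtrace (reindex (@mxtens_index m' n')) /=; last first.
  by exists (@mxtens_unindex m' n') => x _; rewrite ?mxtens_indexK ?mxtens_unindexK.
rewrite (eq_bigr (fun x : 'I_m' * 'I_n' => C x.1 x.1 * D x.2 x.2)); last first.
  by move=> [i j] _; rewrite tensmxE.
rewrite -(pair_bigA _ (fun i j => C i i * D j j)) /= mulr_suml.
by apply: eq_bigr => i _; rewrite mulr_sumr.
Qed.

(** By cyclicity the trace is the inner product of columns [i] and [j] of [C], an entry of
    [C^T *m C = C *m C]. *)
Lemma mxtrace_sqrt_cols n' (M C : 'M[R]_n') i j :
  is_sqrtmx M C -> \tr (col j C *m (col i C)^T) = M i j.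
Proof.
move=> [[Csym _] <-]; rewrite mxtrace_mulC trace_mx11 mxE [RHS]mxE.
apply: eq_bigr => k _; rewrite !mxE; congr (_ * _).
by rewrite -[in LHS]Csym mxE.
Qed.

(** The trace is multiplicative on tensor products, so each tensor has trace [B i j * A k k]; the
    constant undoes the centring in [S_star_of]. *)
Lemma mxtrace_A_diamond (rA : 'M[R]_m) (rB : 'M[R]_n) (u : 'M[R]_(n, m)) :
  is_sqrtmx A rA -> is_sqrtmx B rB ->
  \tr (A_diamond rA rB u q) = S_star_of A B p u q +
    \sum_k \sum_i \sum_(j | i != j) A k k * B i j * q i 0 * q j 0 * p k ^+ 2.
Proof.
move=> hA hB; rewrite raddf_sum -big_split; apply: eq_bigr => k _ /=.
rewrite raddf_sum -big_split; apply: eq_bigr => i _ /=.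
rewrite raddf_sum -big_split; apply: eq_bigr => j _ /=.
rewrite mxtraceZ mxtrace_tens (mxtrace_sqrt_cols _ _ hA) (mxtrace_sqrt_cols _ _ hB).
by ring.
Qed.

Context {d : measure_display} {T : measurableType d}.
Variables (P : probability T R) (U : 'I_n -> 'I_m -> {RV P >-> bool}).
Hypotheses (p01 : forall k, 0 <= p k <= 1).
Hypotheses (hU : forall i k, distribution P (U i k) = bernoulli_prob (p k)).
Hypothesis hUind : mutually_independent P (fun ik : 'I_n * 'I_m => U ik.1 ik.2).

Let mtrue i k : measurable (U i k @^-1` [set true]).
Proof. by rewrite -[_ @^-1` _]setTI; exact: measurable_funP. Qed.

Let pairE i j k w :
  (U i k w)%:R * (U j k w)%:R = \1_(U i k @^-1` [set true] `&` U j k @^-1` [set true]) w :> R.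
Proof.
have mem l : (w \in U l k @^-1` [set true]) = U l k w.
  by apply/idP/idP => [/set_mem|h]; [|apply/mem_set].
rewrite indicE in_setI !mem.
by case: (U i k w); case: (U j k w); rewrite ?mulr1 ?mulr0 ?mul0r.
Qed.

Let integrable_pair i j k :
  P.-integrable setT (EFin \o (fun w => (U i k w)%:R * (U j k w)%:R : R)).
Proof.
rewrite (_ : _ \o _ = EFin \o \1_(U i k @^-1` [set true] `&` U j k @^-1` [set true])).
  by apply: integrable_indic => //; exact: measurableI.
by apply/funext => w /=; rewrite pairE.
Qed.

Let mean_pair i j k : i != j ->
  (\int[P]_w ((U i k w)%:R * (U j k w)%:R : R)%:E = (p k ^+ 2)%:E)%E.
Proof.
move=> ij; under eq_integral do rewrite pairE.
rewrite integral_indic ?setIT //; last exact: measurableI.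
have := @hUind [set (i, k); (j, k)]%SET (fun=> [set true]) (fun _ => I).
rewrite big_setU1 ?inE ?xpair_eqE ?(negbTE ij) //= big_set1 /=.
have pE l : P (U l k @^-1` [set true]) = (p k)%:E.
  rewrite -[LHS]/(distribution P (U l k) [set true]) hU /bernoulli_prob p01.
  by rewrite fsbig_set1.
rewrite !pE => hP; rewrite expr2 EFinM -hP.
congr (P _); apply/seteqP; split => w /=.
  by move=> [iw jw] x; rewrite /= !inE => /orP[] /eqP ->.
by move=> h; split; [apply: (h (i, k))|apply: (h (j, k))]; rewrite /= !inE eqxx ?orbT.
Qed.

(** Every term is centred, since [i != j] makes the two Bernoulli factors independent. This
    identifies the constant in the trace formula as the mean of the quadratic form. *)
Lemma S_star_mean :
  P.-integrable setT (EFin \o (fun w => S_star_of A B p (random_matrix U w) q)) /\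
  (\int[P]_w (S_star_of A B p (random_matrix U w) q)%:E = 0)%E.
Proof.
pose term (w : T) i j k : R := A k k * B i j * q i 0 * q j 0 *
  ((U i k w)%:R * (U j k w)%:R - p k ^+ 2).
have termE w : (S_star_of A B p (random_matrix U w) q)%:E =
    (\sum_k \sum_i \sum_(j | i != j) (term w i j k)%:E)%E.
  rewrite /S_star_of -sumEFin; apply: eq_bigr => k _.
  rewrite -sumEFin; apply: eq_bigr => i _; rewrite -sumEFin; apply: eq_bigr => j _.
  by rewrite /term !mxE.
have iD i j k :
    P.-integrable setT (fun w => ((U i k w)%:R * (U j k w)%:R - p k ^+ 2 : R)%:E).
  exact: (integrableB measurableT (integrable_pair i j k)
    (finite_measure_integrable_cst P (p k ^+ 2) measurableT)).
have iT i j k : P.-integrable setT (fun w => (term w i j k)%:E).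
  exact: (integrableZl measurableT (A k k * B i j * q i 0 * q j 0) (iD i j k)).
have iS : P.-integrable setT (EFin \o (fun w => S_star_of A B p (random_matrix U w) q)).
  rewrite (_ : _ \o _ = fun w => (\sum_k \sum_i \sum_(j | i != j) (term w i j k)%:E)%E).
    by do 3 (apply: integrable_sum => // ? _).
  by apply/funext => w; exact: termE.
split=> //; under eq_integral do rewrite termE.
rewrite integral_sum //; last by move=> k; do 2 (apply: integrable_sum => // ? _).
apply: big1 => k _; rewrite integral_sum //; last first.
  by move=> i; apply: integrable_sum.
apply: big1 => i _; rewrite integral_sum //; apply: big1 => j ij.
under eq_integral do rewrite /term EFinM.
rewrite (integralZl measurableT (iD i j k)).
under eq_integral do rewrite EFinB.
rewrite integralB_EFin //; last exact: finite_measure_integrable_cst.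
rewrite mean_pair // integral_cst //= probability_setT mule1.
by rewrite subee ?mule0.
Qed.

End SStarMean.

Lemma S_star_cond_expectation (R : realType) (m n : nat) (A : 'M[R]_m) (B : 'M[R]_n)
    (p : 'I_m -> R) (q : 'cV[R]_n) (p01 : forall k, 0 <= p k <= 1)
    (d : measure_display) (T : measurableType d) (P : probability T R)
    (U : 'I_n -> 'I_m -> {RV P >-> bool})
    (hU : forall i k, distribution P (U i k) = bernoulli_prob (p k))
    (hUind : mutually_independent P (fun ik : 'I_n * 'I_m => U ik.1 ik.2))
    (rA : 'M[R]_m) (rB : 'M[R]_n) (hrA : is_sqrtmx A rA) (hrB : is_sqrtmx B rB)
    (Z : 'I_(n * m) -> {RV P >-> R}) (hZind : mutually_independent P Z)
    (hZ0 : forall l, ('E_P[Z l] = 0)%E) (hZ1 : forall l, ('V_P[Z l] = 1)%E) :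
  let sigmaU := sigma_of (fun ik : 'I_n * 'I_m => U ik.1 ik.2) in
  independent_sigma P sigmaU (sigma_of Z) ->
  let Q := fun w : T =>
    qform (A_diamond rA rB (random_matrix U w) q) (random_vector Z w) in
  is_cond_expectation P sigmaU Q
    (fun w => S_star_of A B p (random_matrix U w) q + fine 'E_P[Q]%E).
Proof.
move=> sigmaU hUZ Q.
pose X (x : 'I_n * 'I_m) : {RV P >-> bool} := U x.1 x.2.
pose mat (u : {ffun 'I_n * 'I_m -> bool}) : 'M[R]_(n, m) :=
  \matrix_(i, k) (u (i, k))%:R.
have matE w : random_matrix U w = mat (joint_value X w).
  by apply/matrixP => i k; rewrite !mxE ffunE.
pose M u := A_diamond rA rB (mat u) q.
have QE : Q = fun w => qform (M (joint_value X w)) (random_vector Z w).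
  by apply/funext => w; rewrite /Q matE.
pose k0 := \sum_k \sum_i \sum_(j | i != j) A k k * B i j * q i 0 * q j 0 * p k ^+ 2.
have trE w : \tr (M (joint_value X w)) = S_star_of A B p (random_matrix U w) q + k0.
  by rewrite /M -matE (mxtrace_A_diamond p q (random_matrix U w) hrA hrB).
have [iS mS] := S_star_mean A B q p01 hU hUind.
(* The integral identity on the whole space, combined with the zero mean of S_star. *)
have EQ : ('E_P[Q] = k0%:E)%E.
  rewrite expectation.unlock QE (integral_qform hZind hZ0 hZ1 hUZ); last first.
    exact: (@measurableT _ (g_sigma_algebraType (sigma_gen X))).
  under eq_integral do rewrite trE EFinD.
  rewrite integralD_EFin //; last exact: finite_measure_integrable_cst.
  by rewrite mS integral_cst //= probability_setT mule1 add0e.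
(* As a function of [joint_value X] the candidate is both integrable and measurable for the
   sigma-algebra of [U]. *)
have YE : (fun w => S_star_of A B p (random_matrix U w) q + fine 'E_P[Q]%E) =
    (fun u => S_star_of A B p (mat u) q + k0) \o joint_value X.
  by apply/funext => w; rewrite EQ /= matE.
split.
- by rewrite QE; exact: (integrable_qform hZind hZ0 hZ1 hUZ).
- rewrite YE; apply: (integrable_joint (fun u => S_star_of A B p (mat u) q + k0)) => //.
- move=> C mC; rewrite YE; apply: sigma_of_preimage mC.
  by apply: measurable_fun_joint => x; exact: measurable_fun_sigma_gen.
move=> E UE; rewrite EQ QE (integral_qform hZind hZ0 hZ1 hUZ M UE).
by apply: eq_integral => w _; rewrite trE.
Qed.

Theorem corollary4p5 (R : realType) :
  exists c : R, 0 < c /\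
  forall (m n : nat) (hm : (0 < m)%N) (hn : (0 < n)%N)
    (A0 : 'M[R]_m) (B0 : 'M[R]_n)
    (hA0 : sym_posdef A0) (hB0 : sym_posdef B0) (htr : \tr B0 = n%:R)
    (p : 'I_m -> R) (hp : forall k, 0 <= p k <= 1)
    (d : measure_display) (T : measurableType d) (P : probability T R)
    (U : 'I_n -> 'I_m -> {RV P >-> bool})
    (hU : forall i k, distribution P (U i k) = bernoulli_prob (p k))
    (hUind : mutually_independent P (fun ik : 'I_n * 'I_m => U ik.1 ik.2))
    (q : 'cV[R]_n) (hq : norm2 q = 1),
  let S_star := fun w : T => S_star_of A0 B0 p (random_matrix U w) q in
  let sigmaU := sigma_of (fun ik : 'I_n * 'I_m => U ik.1 ik.2) in
  let a_inf := max_diag A0 in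
  (forall (rA : 'M[R]_m) (rB : 'M[R]_n)
      (hrA : is_sqrtmx A0 rA) (hrB : is_sqrtmx B0 rB)
      (Z : 'I_(n * m) -> {RV P >-> R})
      (hZsub : subgaussian_vector P Z)
      (hZind : mutually_independent P Z)
      (hZ0 : forall l, ('E_P[Z l] = 0)%E)
      (hZ1 : forall l, ('V_P[Z l] = 1)%E)
      (hUZ : independent_sigma P sigmaU (sigma_of Z)),
    let Q := fun w : T =>
      qform (A_diamond rA rB (random_matrix U w) q) (random_vector Z w) in
    is_cond_expectation P sigmaU Q (fun w => S_star w + fine 'E_P[Q]%E))
  /\
  (forall t : R, 0 < t ->
    (P [set w | (t < `|S_star w|)%R] <=
     2%:E * expeR (- (c%:E *
       mine ((t ^+ 2)%:E /
             (a_inf * opnorm2 B0 * opnorm2 (abs_mx B0) *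
              \sum_(k < m) A0 k k * p k ^+ 2)%:E)
            (t%:E / (a_inf * opnorm2 B0)%:E))))%E).
Proof.
(* The value 36 is 4 times 9: the 9 of the moment bound and the 4 from minimising the quadratic
   Chernoff exponent. *)
exists (1 / 36); split; first by rewrite divr_gt0.
move=> m n hm hn A0 B0 hA0 hB0 _ p hp d T P U hU hUind q hq S_star sigmaU a_inf.
split; last by move=> t; exact: S_star_tail.
move=> rA rB hrA hrB Z _ hZind hZ0 hZ1 hUZ Q.
exact: S_star_cond_expectation hUZ.
Qed.
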